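(* (Necessary condition for identifiability.) For $L,L'\in\mathbb{N}$, let $C(P(\mathcal{M}^L)-P(\mathcal{M}^{L'}))$ be the set of all points on all lines through the origin intersecting $P(\mathcal{M}^L)-P(\mathcal{M}^{L'})$ (at a nonzero point), and let $q$ be the maximal dimension of a linear space contained in $C(P(\mathcal{M}^L)-P(\mathcal{M}^{L'}))$. Then, if $q>\mathrm{rk}(\mathcal{A})$, $\mathcal{M}$ is not identifiable. In particular, when the sets $P(\mathcal{M}^L)$ contain linear spaces, and if $S'$ denotes the largest dimension of these linear spaces: if $2S'>\mathrm{rk}(\mathcal{A})$, then $\mathcal{M}$ is not identifiable.
   Context: $K\geq 1$, $S\geq 2$ are integers, $[K]=\{1,\dots,K\}$, $[S]=\{1,\dots,S\}$. An element $\mathbf{h}\in\mathbb{R}^{S\times K}$ is a $K$-tuple of vectors $\mathbf{h}_1,\dots,\mathbf{h}_K\in\mathbb{R}^S$ with entries $\mathbf{h}_{k,i}$. $\mathbb{R}^{S^K}$ is the space of real order-$K$ tensors whose axes are of size $S$. $P:\mathbb{R}^{S\times K}\to\mathbb{R}^{S^K}$ is defined by $P(\mathbf{h})_{\mathbf{i}}=\mathbf{h}_{1,i_1}\cdots\mathbf{h}_{K,i_K}$ for $\mathbf{i}=(i_1,\dots,i_K)\in[S]^K$. $M_k:\mathbb{R}^S\to\mathbb{R}^{m_k\times m_{k+1}}$ ($k=1,\dots,K$, $m_1=m$, $m_{K+1}=n$) are linear maps and $\mathcal{A}:\mathbb{R}^{S^K}\to\mathbb{R}^{m\times n}$ is the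 unique linear map such that $M_1(\mathbf{h}_1)\cdots M_K(\mathbf{h}_K)=\mathcal{A}P(\mathbf{h})$ for all $\mathbf{h}\in\mathbb{R}^{S\times K}$; $\mathrm{rk}(\mathcal{A})$ is its rank. $\mathcal{M}=(\mathcal{M}^L)_{L\in\mathbb{N}}$ is a collection of models: each $\mathcal{M}^L$ is a nonempty subset of $\mathbb{R}^{S\times K}$. $P(\mathcal{M}^L)-P(\mathcal{M}^{L'})=\{P(\mathbf{h})-P(\mathbf{g}) : \mathbf{h}\in\mathcal{M}^L,\ \mathbf{g}\in\mathcal{M}^{L'}\}$. Equivalence classes: on $\mathbb{R}^{S\times K}_*=\{\mathbf{h}\in\mathbb{R}^{S\times K} : \|\mathbf{h}_k\|\neq0\ \forall k\in[K]\}$, $\mathbf{h}\sim\mathbf{g}$ if and only if there are $\lambda_1,\dots,\lambda_K\in\mathbb{R}$ with $\prod_{k=1}^K\lambda_k=1$ and $\mathbf{h}_k=\lambda_k\mathbf{g}_k$ for all $k\in[K]$; $\langle\mathbf{h}\rangle$ is the equivalence class of $\mathbf{h}$. Identifiability: for $\overline{L}\in\mathbb{N}$ and $\overline{\mathbf{h}}\in\mathcal{M}^{\overline{L}}$, put $X=M_1(\overline{\mathbf{h}}_1)\cdots M_K(\overline{\mathbf{h}}_K)=\mathcal{A}P(\overline{\mathbf{h}})$. $\langle\overline{\mathbf{h}}\rangle$ is identifiable if the elements of $\langle\overline{\mathbf{h}}\rangle$ are the only minimizers of $\|M_1(\mathbf{h}_1)\cdots M_K(\mathbf{h}_K)-X\|^2$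 over $L\in\mathbb{N}$, $\mathbf{h}\in\mathcal{M}^L$. $\mathcal{M}$ is identifiable if for every $L\in\mathbb{N}$ and every $\overline{\mathbf{h}}\in\mathcal{M}^L$, $\langle\overline{\mathbf{h}}\rangle$ is identifiable.
   Formalization: The second part additionally assumes that two linear spaces of the largest dimension S', one in some P(M^L) and one in some P(M^{L'}), meet only in 0; without this it is false (K=1, M^L=R^S, M_1 injective). *)

(* Defs.v *)
From HB Require Import structures.
From mathcomp Require Import all_boot all_order all_algebra.
From mathcomp Require Import classical_sets reals.

Set Implicit Arguments.
Unset Strict Implicit.
Unset Printing Implicit Defensive.
Import Order.TTheory GRing.Theory Num.Theory.
Local Open Scope ring_scope.
Local Open Scope classical_set_scope.

(* R^(S x K), with 0-based indices: the entry h_{k,i} is [h k 0 i]. *)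
Notation param R K S := {ffun 'I_K -> 'rV[R]_S}.

(* Real tensors of order K with all axes of size S; a multi-index is a function
   'I_K -> 'I_S. The codomain is R^o so that this is a vectType over R. *)
Notation tensor R K S := {ffun {ffun 'I_K -> 'I_S} -> R^o}.

Definition enorm (R : realType) (m n : nat) (A : 'M[R]_(m, n)) : R :=
  Num.sqrt (\sum_i \sum_j A i j ^+ 2).

Definition segre (R : realType) (K S : nat) (h : param R K S) : tensor R K S :=
  [ffun i : {ffun 'I_K -> 'I_S} => \prod_(k < K) h k 0 (i k)].

(* The ordered product F_0 *m ... *m F_(K-1) of compatible rectangular
   matrices; [d 0], ..., [d K] are the sizes m_1, ..., m_(K+1). *)
Fixpoint chain_mul (R : realType) (d : nat -> nat) (K : nat) :
    (forall k : 'I_K, 'M[R]_(d k, d k.+1)) -> 'M[R]_(d 0%N, d K) :=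
  match K with
  | 0 => fun _ => 1%:M
  | K'.+1 => fun F =>
      chain_mul (fun k : 'I_K' => F (widen_ord (leqnSn K') k)) *m F ord_max
  end.

Section Identifiability.
Variables (R : realType) (K S : nat) (d : nat -> nat).
Variable Mk : forall k : 'I_K, {linear 'rV[R]_S -> 'M[R]_(d k, d k.+1)}.
Variable M : nat -> set (param R K S).
Implicit Types h g : param R K S.

Definition network h : 'M[R]_(d 0%N, d K) := chain_mul (fun k => Mk k (h k)).

Definition in_Rstar h : Prop := forall k, enorm (h k) != 0.

Definition equivp h g : Prop :=
  [/\ in_Rstar h, in_Rstar g
    & exists lambda : 'I_K -> R,
        \prod_k lambda k = 1 /\ forall k, h k = lambda k *: g k].

Definition eqclass h : set (param R K S) := [set g | equivp g h].

Definition minimizer (X : 'M[R]_(d 0%N, d K)) (L : nat) h : Prop :=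
  M L h /\
  forall (L' : nat) g, M L' g ->
    enorm (network h - X) ^+ 2 <= enorm (network g - X) ^+ 2.

Definition class_identifiable h : Prop :=
  forall (L : nat) g, M L g -> (minimizer (network h) L g <-> eqclass h g).

(* The relation is an equivalence only on R^(S x K)_*, so only classes of such h
   are quantified over; the competitors in [class_identifiable] may be
   degenerate. *)
Definition identifiable : Prop :=
  forall (L : nat) h, M L h -> in_Rstar h -> class_identifiable h.

End Identifiability.

Definition set_sub (T : zmodType) (A B : set T) : set T :=
  [set x - y | x in A & y in B].

Definition line_cone (R : realType) (T : vectType R) (D : set T) : set T :=
  [set y | exists x, [/\ D x, x != 0 & y \in <[x]>%VS]].

Definition vspace_in (R : realType) (T : vectType R) (D : set T)
  (V : {vspace T}) : Prop := forall x, x \in V -> D x.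

Definition is_max_dim (R : realType) (T : vectType R)
    (F : set {vspace T}) (q : nat) : Prop :=
  (exists V, F V /\ \dim V = q) /\ (forall V, F V -> (\dim V <= q)%N).

(* Main.v *)
(* A subspace of dimension larger than rk(A) contains a nonzero x in the kernel
   of A. In both cases x is, up to a scalar, P(h) - P(g) with h and g in models,
   so h and g have the same image X under the network although P(h) <> P(g).
   At least one of P(h), P(g) is nonzero, hence h or g has a class, and the
   other one is a minimizer outside of that class. *)
Require Import Defs.
From HB Require Import structures.
From mathcomp Require Import all_boot all_order all_algebra.
From mathcomp Require Import boolp classical_sets reals.

Set Implicit Arguments.
Unset Strict Implicit.
Unset Printing Implicit Defensive.
Import Order.TTheory GRing.Theory Num.Theory.
Local Open Scope ring_scope.
Local Open Scope classical_set_scope.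

Lemma enorm0 (R : realType) (m n : nat) : enorm (0 : 'M[R]_(m, n)) = 0.
Proof.
by rewrite /enorm big1 ?sqrtr0// => i _; rewrite big1// => j _; rewrite mxE expr0n.
Qed.

Lemma enorm_eq0 (R : realType) (m n : nat) (A : 'M[R]_(m, n)) :
  enorm A = 0 -> A = 0.
Proof.
have row_ge0 i : 0 <= \sum_j A i j ^+ 2 by apply: sumr_ge0 => j _; exact: sqr_ge0.
(* [Num.sqrt] is 0 on all nonpositive reals, so only [<= 0] comes out here; equality follows because
   squares are nonnegative. *)
move/eqP; rewrite sqrtr_eq0 => sum_le0.
have /eqP/psumr_eq0P-/(_ (fun i _ => row_ge0 i)) row0 :
    \sum_i \sum_j A i j ^+ 2 == 0.
  by rewrite eq_le sum_le0 sumr_ge0.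
apply/matrixP => i j; rewrite mxE; apply/eqP; rewrite -sqrf_eq0; apply/eqP.
by have /psumr_eq0P->// := row0 i isT => k _; exact: sqr_ge0.
Qed.

(** Some block [h k] is zero, and each entry of the tensor has a factor taken from it. *)
Lemma segre_eq0 (R : realType) (K S : nat) (h : param R K S) :
  ~ in_Rstar h -> segre h = 0.
Proof.
move=> /existsNP[k /negP/negPn/eqP/enorm_eq0 hk0].
by apply/ffunP => i; rewrite !ffunE (bigD1 k)//= hk0 mxE mul0r.
Qed.

Lemma segre_equivp (R : realType) (K S : nat) (h g : param R K S) :
  equivp h g -> segre h = segre g.
Proof.
move=> [_ _ [l [l1 hl]]]; apply/ffunP => i; rewrite !ffunE.
under eq_bigr do rewrite hl mxE.
by rewrite big_split/= l1 mul1r.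
Qed.

(** Rank-nullity for [f] restricted to [V]: a trivial intersection with the kernel would give
    [\dim V] = dim f(V), which is at most the rank of [f]. *)
Lemma lker_meet_nonzero (F : fieldType) (aT rT : vectType F)
    (f : 'Hom(aT, rT)) (V : {vspace aT}) :
  (\dim (limg f) < \dim V)%N -> exists x, [/\ x \in V, x != 0 & f x = 0].
Proof.
move=> ltfV; exists (vpick (V :&: lker f)%VS).
have /andP[? ?] : (vpick (V :&: lker f) \in V) && (vpick (V :&: lker f) \in lker f).
  by rewrite -memv_cap memv_pick.
split=> //; last by apply/eqP; rewrite -memv_ker.
rewrite vpick0; apply/eqP => Vf0.
have := limg_ker_dim f V; rewrite Vf0 dimv0 add0n => eqfV.
by move: ltfV; rewrite -eqfV ltnNge dimvS// limgS// subvf.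
Qed.

Section NotIdentifiable.
Variables (R : realType) (K S : nat) (d : nat -> nat).
Variable Mk : forall k : 'I_K, {linear 'rV[R]_S -> 'M[R]_(d k, d k.+1)}.
Variable M : nat -> set (param R K S).

(** With target [network Mk h], the objective is 0 at [g], so [g] is a minimizer and lies in the
    class of [h], on which [segre] is constant. *)
Lemma identifiable_segre_eq (L L' : nat) (h g : param R K S) :
  identifiable Mk M -> M L h -> M L' g -> in_Rstar h ->
  network Mk h = network Mk g -> segre h = segre g.
Proof.
move=> idM Mh Mg h_star eq_hg; apply/esym/segre_equivp.
apply/(idM L h Mh h_star L' g Mg); split=> // L'' g' _.
by rewrite eq_hg subrr enorm0 expr0n sqr_ge0.
Qed.

Lemma not_identifiable (L L' : nat) (h g : param R K S) :
  M L h -> M L' g -> network Mk h = network Mk g -> segre h != segre g ->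
  ~ identifiable Mk M.
Proof.
move=> Mh Mg eq_hg /eqP neq_hg idM; apply: (neq_hg).
(* Identifiability constrains only nondegenerate targets: take [h] as target if possible, else [g];
   if both are degenerate, both tensors are 0. *)
have [h_star|/segre_eq0 h0] := pselect (in_Rstar h).
  exact: identifiable_segre_eq idM Mh Mg h_star eq_hg.
have [g_star|/segre_eq0 g0] := pselect (in_Rstar g); last by rewrite h0 g0.
by apply/esym; apply: identifiable_segre_eq idM Mg Mh g_star (esym eq_hg).
Qed.

End NotIdentifiable.

Theorem theorem6p5 (R : realType) (K S : nat) (hK : (1 <= K)%N) (hS : (2 <= S)%N)
    (d : nat -> nat)
    (Mk : forall k : 'I_K, {linear 'rV[R]_S -> 'M[R]_(d k, d k.+1)})
    (A : 'Hom(tensor R K S, 'M[R]_(d 0%N, d K)))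
    (hA : forall h : param R K S, network Mk h = A (segre h))
    (M : nat -> set (param R K S))
    (hM : forall L : nat, M L !=set0) :
  (forall L L' q : nat,
     is_max_dim
       [set V : {vspace tensor R K S} | vspace_in
          (line_cone (set_sub (@segre R K S @` M L) (@segre R K S @` M L'))) V] q ->
     (\dim (limg A) < q)%N ->
     ~ identifiable Mk M)
  /\
  (forall S' : nat,
     is_max_dim
       [set V : {vspace tensor R K S} |
          exists L : nat, vspace_in (@segre R K S @` M L) V] S' ->
     (exists (L L' : nat) (V V' : {vspace tensor R K S}),
        [/\ vspace_in (@segre R K S @` M L) V,
            vspace_in (@segre R K S @` M L') V',
            \dim V = S', \dim V' = S' & (V :&: V' = 0)%VS]) ->
     (\dim (limg A) < 2 * S')%N ->
     ~ identifiable Mk M).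
Proof.
split=> [L L' q [[V [V_cone <-]] _] /lker_meet_nonzero[x [xV x_neq0 Ax0]]|].
  have [y [[_ [h Mh <-] [_ [g Mg <-] def_y]] y_neq0]] := V_cone x xV.
  move=> /vlineP[c def_x]; apply: (not_identifiable Mh Mg); last first.
    by rewrite -subr_eq0 def_y.
  (* Being nonzero, [c] can be cancelled from [A x = c *: A y = 0], which puts [y] itself in the
     kernel. *)
  have c_neq0 : c != 0 by apply: contraNneq x_neq0 => c0; rewrite def_x c0 scale0r.
  apply/eqP; rewrite !hA -subr_eq0 -linearB def_y.
  by move/eqP: Ax0; rewrite def_x linearZ scaler_eq0 (negbTE c_neq0).
move=> S' _ [L [L' [V [V' [V_P V'_P dimV dimV' VV'0]]]]].
(* The sum of [V] and [V'] is direct, so its dimension is [2 * S'] and it meets the kernel of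
   [A]. *)
rewrite mul2n -addnn -{1}dimV -dimV' -dimv_disjoint_sum//.
move=> /lker_meet_nonzero[_ [/memv_addP[v vV [v' v'V' ->]] x_neq0 Ax0]].
have [h Mh def_v] := V_P v vV.
(* The sign turns the kernel vector [v + v'] into the difference [segre h - segre g]. *)
have [|g Mg def_v'] := V'_P (- v'); first by rewrite memvN.
apply: (not_identifiable Mh Mg); last by rewrite -subr_eq0 def_v def_v' opprK.
by apply/eqP; rewrite !hA -subr_eq0 -linearB/= def_v def_v' opprK Ax0.
Qed.
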